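(* Let $n\ge 2$ and order $\mathcal{S}_n=(p_0,p_1,\ldots,p_{n!-1})$ by generation by cyclic shift. For $p\in\mathcal{S}_n$, let $p^{(1)}=(x_1),p^{(2)},\ldots,p^{(n)}=p$ be the unique sequence with $p^{(m)}\in\mathcal{S}_m$ and $p^{(m)}=S_m^{c_m}p^{(m-1)}$ for some $c_m\in\{0,\ldots,m-1\}$ ($m=2,\ldots,n$), and define the code of $p$ as $\alpha=\sum_{i=0}^{n-2}\alpha_i\varpi_{n,i}$ with $\alpha_i=c_{n-i}$. Then the rank of $p$ (its index in the ordering, an element of $\mathbb{Z}_{n!}$) equals its code. Conversely, for $\alpha\in\mathbb{Z}_{n!}$ with $\varpi$-system digits $\alpha_{n-2},\ldots,\alpha_0$, the permutation $p_\alpha$ is obtained from $(x_1)$ by successively applying $S_2^{\alpha_{n-2}},S_3^{\alpha_{n-3}},\ldots,S_n^{\alpha_0}$.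
   Context: Let $x_1,x_2,\ldots$ be distinct symbols; $\mathcal{S}_m$ is the set of words in which each of $x_1,\ldots,x_m$ occurs exactly once. For $q=(a_1\cdots a_{m-1})\in\mathcal{S}_{m-1}$ and $j\in\{0,\ldots,m-1\}$, the cyclic shift is $S_m^jq=C^j(a_1\cdots a_{m-1}x_m)\in\mathcal{S}_m$, where $C(c_1c_2\cdots c_m)=(c_2\cdots c_mc_1)$. Ordering by generation by cyclic shift: $\mathcal{S}_1=((x_1))$; if $\mathcal{S}_{m-1}$ is ordered as $(q_0,\ldots,q_{(m-1)!-1})$, then $\mathcal{S}_m$ is ordered as $(p_0,\ldots,p_{m!-1})$ with $p_{m\beta+j}=S_m^jq_\beta$ for $\beta\in\{0,\ldots,(m-1)!-1\}$, $j\in\{0,\ldots,m-1\}$. The $\varpi$-system: $\varpi_{n,0}=1$, $\varpi_{n,i}=n(n-1)\cdots(n-i+1)$ for $1\le i\le n-2$; each $\alpha\in\mathbb{Z}_{n!}$ (identified with $\{0,\ldots,n!-1\}$) is uniquely $\alpha=\sum_{i=0}^{n-2}\alpha_i\varpi_{n,i}$ with digits $\alpha_i\in\{0,\ldots,n-i-1\}$. *)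

(* Defs.v *)
From mathcomp Require Import all_boot.
Set Implicit Arguments.
Unset Strict Implicit.
Unset Printing Implicit Defensive.

(* The symbol x_i is [x i], for i >= 1; the value [x 0] is never used. *)
Definition distinct_symbols (T : eqType) (x : nat -> T) : Prop :=
  {in [pred i | 0 < i] &, injective x}.

Definition permword (T : eqType) (x : nat -> T) (m : nat) (p : seq T) : bool :=
  perm_eq p [seq x i | i <- iota 1 m].

(* S_m^j q, with C = rot 1; meant for q in S_{m-1} and j < m. *)
Definition cshift (T : Type) (x : nat -> T) (m j : nat) (q : seq T) : seq T :=
  iter j (rot 1) (rcons q (x m)).

(* S_m listed by generation by cyclic shift (the case m = 0 is a dummy).
   The k-th word is S_m^j q_beta for k = m * beta + j, see nth_cyc_order. *)
Fixpoint cyc_order (T : Type) (x : nat -> T) (m : nat) : seq (seq T) :=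
  match m with
  | 0 => [::]
  | 1 => [:: [:: x 1]]
  | m'.+1 =>
      mkseq (fun k => cshift x m (k %% m) (nth [::] (cyc_order x m') (k %/ m)))
            m`!
  end.

Definition cyc_rank (T : eqType) (x : nat -> T) (n : nat) (p : seq T) : nat :=
  index p (cyc_order x n).

(* [P m] is p^(m) for 1 <= m <= n and [c m] is c_m for 2 <= m <= n;
   the values outside these ranges are irrelevant. *)
Definition shift_chain (T : eqType) (x : nat -> T) (n : nat) (p : seq T)
    (P : nat -> seq T) (c : nat -> nat) : Prop :=
  [/\ P 1 = [:: x 1],
      P n = p,
      forall m, 1 <= m <= n -> permword x m (P m) &
      forall m, 2 <= m <= n -> c m < m /\ P m = cshift x m (c m) (P m.-1)].

(* The base varpi_{n,i} = n (n-1) ... (n-i+1) is the falling factorial n ^_ i. *)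
Definition varpi_sum (n : nat) (a : nat -> nat) : nat :=
  \sum_(i < n.-1) a i * n ^_ i.

Definition varpi_digits (n : nat) (a : nat -> nat) (alpha : nat) : Prop :=
  (forall i, i < n.-1 -> a i < n - i) /\ alpha = varpi_sum n a.

Definition chain_code (n : nat) (c : nat -> nat) : nat :=
  varpi_sum n (fun i => c (n - i)).

(* S_2^{a_{n-2}}, S_3^{a_{n-3}}, ..., S_n^{a_0} applied in turn to (x_1). *)
Definition apply_shifts (T : Type) (x : nat -> T) (n : nat) (a : nat -> nat) :
    seq T :=
  foldl (fun q m => cshift x m (a (n - m)) q) [:: x 1] (iota 2 n.-1).

Lemma size_cyc_order (T : Type) (x : nat -> T) (m : nat) :
  0 < m -> size (cyc_order x m) = m`!.
Proof. by case: m => [|[|m]] // _; rewrite size_mkseq. Qed.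

Lemma nth_cyc_order (T : Type) (x : nat -> T) (m beta j : nat) :
  1 < m -> beta < (m.-1)`! -> j < m ->
  nth [::] (cyc_order x m) (m * beta + j) =
  cshift x m j (nth [::] (cyc_order x m.-1) beta).
Proof.
case: m => [|[|m]] //= _ lt_beta lt_j.
rewrite nth_mkseq; last first.
  rewrite factS (@leq_trans (m.+2 * beta.+1)) ?leq_mul2l //.
  by rewrite mulnS addnC ltn_add2r.
by rewrite mulnC modnMDl divnMDl // modn_small // divn_small // addn0.
Qed.

Lemma varpi_digits_exists (n alpha : nat) :
  0 < n -> alpha < n`! -> exists a, varpi_digits n a alpha.
Proof.
move=> n0 lt_alpha; pose a i := (alpha %/ n ^_ i) %% (n - i).
exists a; split=> [i lt_i|].
  by rewrite ltn_mod subn_gt0 (leq_trans lt_i) ?leq_pred.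
have E k : alpha = \sum_(i < k) a i * n ^_ i + alpha %/ n ^_ k * n ^_ k.
  elim: k => [|k IH]; first by rewrite big_ord0 ffactn0 divn1 muln1.
  rewrite big_ord_recr /= {1}IH -addnA; congr (_ + _).
  rewrite ffactnSr divnMA {1}(divn_eq (alpha %/ n ^_ k) (n - k)) mulnDl addnC.
  by rewrite -mulnA [(n - k) * _]mulnC.
have Ef : n ^_ n.-1 = n`!.
  by case: n n0 {lt_alpha a E} => // n _; rewrite -ffactnn ffactnSr subSnn muln1.
by rewrite {1}(E n.-1) Ef (divn_small lt_alpha) mul0n addn0.
Qed.

Lemma varpi_digits_unique (n alpha : nat) (a b : nat -> nat) :
  varpi_digits n a alpha -> varpi_digits n b alpha ->
  forall i, i < n.-1 -> a i = b i.
Proof.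
move=> [ha ->] [hb]; rewrite /varpi_sum.
suff H k : k <= n.-1 ->
    \sum_(i < k) a i * n ^_ i = \sum_(i < k) b i * n ^_ i ->
    forall i, i < k -> a i = b i by exact: H.
elim: k => [|k IH] // lt_k.
have lt_sum (d : nat -> nat) : (forall i, i < n.-1 -> d i < n - i) ->
    forall l, l <= n.-1 -> \sum_(i < l) d i * n ^_ i < n ^_ l.
  move=> hd; elim=> [|l IHl] lt_l; first by rewrite big_ord0.
  rewrite big_ord_recr /= ffactnSr [ltnRHS]mulnC.
  apply: (@leq_trans ((d l).+1 * n ^_ l)).
    by rewrite mulSn ltn_add2r IHl // ltnW.
  by rewrite leq_mul2r hd ?orbT.
have pos : 0 < n ^_ k by rewrite ffact_gt0 (leq_trans (ltnW lt_k)) ?leq_pred.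
rewrite !big_ord_recr /= => E.
have Ek : a k = b k.
  have := congr1 (fun s => s %/ n ^_ k) E; rewrite /= addnC [in RHS]addnC.
  by rewrite !divnMDl // !divn_small ?lt_sum ?(ltnW lt_k) // !addn0.
move: E; rewrite Ek => /addIn E i; rewrite ltnS leq_eqVlt => /orP[/eqP->//|].
exact: IH (ltnW lt_k) E i.
Qed.

(* Main.v *)
Require Import Defs.
From mathcomp Require Import all_boot.
Set Implicit Arguments.
Unset Strict Implicit.
Unset Printing Implicit Defensive.

(* Write p = u x_m v in S_m. Then p = S_m^j q exactly for q = v u and j = |v|,
   so S_{m-1} x {0, ..., m-1} -> S_m, (q, j) |-> S_m^j q, is a bijection. The
   chain and its shifts c_2, ..., c_n are therefore unique, and the listing has
   no repetition. Moving from m - 1 to m, the index k becomes m k + c_m, and by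
   m ^_ (i + 1) = m * (m - 1) ^_ i the code satisfies the same recursion. *)

(** The bound on [j] keeps [x m] from being rotated past the front, so the rotations only carry the
    first [j] letters of [q] behind it. *)
Lemma cshiftE (T : Type) (x : nat -> T) (m j : nat) (q : seq T) :
  j <= size q -> cshift x m j q = drop j q ++ x m :: take j q.
Proof.
move=> le_j; have -> : cshift x m j q = rot j (rcons q (x m)).
  rewrite /cshift; elim: j le_j => [|j IH] lt_j; first by rewrite rot0.
  by rewrite iterS IH ?(ltnW lt_j) // -rotD // size_rcons ltnW.
by rewrite /rot drop_rcons // -(cats1 q) takel_cat // cat_rcons.
Qed.

Lemma permwordS (T : eqType) (x : nat -> T) (m : nat) (p : seq T) :
  permword x m.+1 p = perm_eq p (x m.+1 :: [seq x i | i <- iota 1 m]).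
Proof.
rewrite /permword -(addn1 m) iotaD map_cat /= cats1 add1n.
by rewrite perm_sym perm_rcons perm_sym addn1.
Qed.

Lemma size_permword (T : eqType) (x : nat -> T) (m : nat) (p : seq T) :
  permword x m p -> size p = m.
Proof. by move/perm_size->; rewrite size_map size_iota. Qed.

Lemma permword_cshift (T : eqType) (x : nat -> T) (m j : nat) (q : seq T) :
  j <= m -> permword x m q -> permword x m.+1 (cshift x m.+1 j q).
Proof.
move=> le_j qP; rewrite permwordS cshiftE ?(size_permword qP) //.
by rewrite perm_catC /= perm_cons cat_take_drop.
Qed.

Lemma permword_cshift_inv (T : eqType) (x : nat -> T) (m : nat) (p : seq T) :
  permword x m.+1 p ->
  exists q j, [/\ permword x m q, j <= m & p = cshift x m.+1 j q].
Proof.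
rewrite permwordS => pP.
have xp : x m.+1 \in p by rewrite (perm_mem pP) mem_head.
case/splitPr: p / xp pP => u v pP.
have qP : permword x m (v ++ u).
  by rewrite perm_catC /= perm_cons perm_catC in pP; rewrite perm_catC in pP.
exists (v ++ u), (size v); split=> //.
  by rewrite -(size_permword qP) size_cat leq_addr.
by rewrite cshiftE ?size_cat ?leq_addr // drop_size_cat ?take_size_cat.
Qed.

(** Distinctness of the symbols enters here: if [x m.+1] were a letter of [q], an index at most [m]
    would have to equal [m.+1]. *)
Lemma last_notin_permword (T : eqType) (x : nat -> T) (m : nat) (q : seq T) :
  distinct_symbols x -> permword x m q -> x m.+1 \notin q.
Proof.
move=> hx /perm_mem->; apply/mapP => -[i]; rewrite mem_iota => /andP[i0 lt_i].
by move/hx => E; move: lt_i; rewrite -E ?inE // add1n ltnn.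
Qed.

(* The position of x_{m+1} in the shifted word is m - j. *)
Lemma cshift_inj (T : eqType) (x : nat -> T) (m j j' : nat) (q q' : seq T) :
  distinct_symbols x -> permword x m q -> permword x m q' ->
  j <= m -> j' <= m -> cshift x m.+1 j q = cshift x m.+1 j' q' ->
  q = q' /\ j = j'.
Proof.
move=> hx qP qP' le_j le_j'.
have sz := size_permword qP; have sz' := size_permword qP'.
rewrite !cshiftE ?sz ?sz' // => E.
have idx r i : permword x m r ->
    index (x m.+1) (drop i r ++ x m.+1 :: take i r) = m - i.
  move=> rP; have := last_notin_permword hx rP => nr.
  rewrite index_cat (contraNF (@mem_drop _ _ _ _) nr) /= eqxx addn0.
  by rewrite size_drop (size_permword rP).
have Ej : j = j'.
  have := congr1 (index (x m.+1)) E; rewrite !idx // => Em.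
  (* Truncated subtraction from [m] is injective on numbers at most [m]; hence the bounds on both
     shifts. *)
  by rewrite -(subKn le_j) Em subKn.
move: E; rewrite -Ej => /eqP; rewrite eqseq_cat ?size_drop ?sz ?sz' //.
rewrite eqseq_cons eqxx => /andP[/eqP Ed /eqP Et]; split=> //.
by rewrite -(cat_take_drop j q) Ed Et cat_take_drop.
Qed.

(** Indexing [c] by word length lets one [c] describe all stages of a chain. At length [n], with
    [c m] equal to [a (n - m)], this unfolds to [apply_shifts x n a]. *)
Definition shift_word (T : Type) (x : nat -> T) (c : nat -> nat) (m : nat) :
    seq T :=
  foldl (fun q k => cshift x k (c k) q) [:: x 1] (iota 2 m.-1).

Definition shift_bounded (c : nat -> nat) (n : nat) : Prop :=
  forall m, 2 <= m <= n -> c m < m.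

Lemma shift_boundedW (c : nat -> nat) (n : nat) :
  shift_bounded c n.+1 -> shift_bounded c n.
Proof. by move=> cP m /andP[m2 le_m]; apply: cP; rewrite m2 leqW. Qed.

Lemma shift_wordS (T : Type) (x : nat -> T) (c : nat -> nat) (m : nat) :
  shift_word x c m.+2 = cshift x m.+2 (c m.+2) (shift_word x c m.+1).
Proof.
by rewrite /shift_word -[m.+2.-1]addn1 iotaD foldl_cat add2n.
Qed.

Lemma eq_shift_word (T : Type) (x : nat -> T) (c c' : nat -> nat) (n : nat) :
  (forall m, 2 <= m <= n -> c m = c' m) ->
  forall m, 1 <= m <= n -> shift_word x c m = shift_word x c' m.
Proof.
move=> E; elim=> [|[|m] IH] // lt_m.
by rewrite !shift_wordS E // IH ?(ltnW lt_m).
Qed.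

Lemma permword_shift_word (T : eqType) (x : nat -> T) (c : nat -> nat)
    (n : nat) :
  shift_bounded c n ->
  forall m, 1 <= m <= n -> permword x m (shift_word x c m).
Proof.
move=> cP; elim=> [|[|m] IH] // lt_m; first exact: perm_refl.
rewrite shift_wordS; apply: permword_cshift; last by rewrite IH ?(ltnW lt_m).
by rewrite -ltnS cP.
Qed.

(** By [cshift_inj] the final word determines the last shift and the word before it; induction
    handles the earlier shifts. *)
Lemma shift_word_inj (T : eqType) (x : nat -> T) (c c' : nat -> nat)
    (n : nat) :
  distinct_symbols x -> shift_bounded c n -> shift_bounded c' n ->
  shift_word x c n = shift_word x c' n ->
  forall m, 2 <= m <= n -> c m = c' m.
Proof.
move=> hx; elim: n => [|[|n] IH] cP cP' E m; try by case: m => [|[|m]].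
have [cW cW'] := (shift_boundedW cP, shift_boundedW cP').
have wP := permword_shift_word x cW; have wP' := permword_shift_word x cW'.
have le_c : c n.+2 <= n.+1 by rewrite -ltnS cP /=.
have le_c' : c' n.+2 <= n.+1 by rewrite -ltnS cP' /=.
rewrite !shift_wordS in E.
have [Ew Ec] := cshift_inj hx (wP n.+1 (leqnn _)) (wP' n.+1 (leqnn _)) le_c le_c' E.
case/andP=> m2; rewrite leq_eqVlt => /orP[/eqP->//|le_m].
by apply: IH => //; rewrite m2.
Qed.

Lemma shift_word_surj (T : eqType) (x : nat -> T) (n : nat) (p : seq T) :
  0 < n -> permword x n p ->
  exists2 c, shift_bounded c n & p = shift_word x c n.
Proof.
elim: n p => [|[|n] IH] p // _ pP.
  exists (fun=> 0); first by move=> [|m].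
  by apply: perm_small_eq pP.
have [q [j [qP le_j ->]]] := permword_cshift_inv pP.
have [c cP ->] := IH q isT qP.
(* The shift [j] that inserts the last symbol extends the sequence [c] of the shorter word. *)
pose c' m := if m == n.+2 then j else c m.
have E m : 2 <= m <= n.+1 -> c m = c' m.
  by case/andP=> _ le_m; rewrite /c' ltn_eqF.
exists c'; last first.
  by rewrite shift_wordS /c' eqxx (eq_shift_word _ E) ?leqnn.
move=> m /andP[m2]; rewrite leq_eqVlt => /orP[/eqP->|le_m].
  by rewrite /c' eqxx.
by rewrite -E ?m2 // cP ?m2.
Qed.

Lemma shift_chain_shift_word (T : eqType) (x : nat -> T) (c : nat -> nat)
    (n : nat) :
  shift_bounded c n ->
  shift_chain x n (shift_word x c n) (shift_word x c) c.
Proof.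
move=> cP; split=> //; first exact: permword_shift_word.
by move=> [|[|m]] // le_m; split; rewrite ?shift_wordS ?cP.
Qed.

(** The first word and the recurrence fix all later words, so uniqueness of a chain reduces to
    uniqueness of its shifts. *)
Lemma shift_chainP (T : eqType) (x : nat -> T) (n : nat) (p : seq T)
    (P : nat -> seq T) (c : nat -> nat) :
  shift_chain x n p P c ->
  shift_bounded c n /\ forall m, 1 <= m <= n -> P m = shift_word x c m.
Proof.
case=> P1 _ _ PS; split=> [m /PS[]//|].
elim=> [|[|m] IH] // lt_m.
by have [_ ->] := PS m.+2 lt_m; rewrite shift_wordS IH ?(ltnW lt_m).
Qed.

(** The summand at [i = 0] is the newest shift, with weight 1; every other weight has a factor
    [m.+2]. The result matches the index recursion in [nth_cyc_order]. *)
Lemma chain_codeS (m : nat) (c : nat -> nat) :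
  chain_code m.+2 c = m.+2 * chain_code m.+1 c + c m.+2.
Proof.
rewrite /chain_code /varpi_sum /= big_ord_recl /= ffactn0 muln1 subn0 addnC.
congr (_ + _); rewrite big_distrr; apply: eq_bigr => i _ /=.
by rewrite ffactnS mulnCA.
Qed.

Lemma chain_code_lt (c : nat -> nat) (n : nat) :
  0 < n -> shift_bounded c n -> chain_code n c < n`!.
Proof.
elim: n => [|[|n] IH] // _ cP; first by rewrite /chain_code /varpi_sum big_ord0.
have {}IH := IH isT (shift_boundedW cP).
(* Since [c n.+2 < n.+2], the code stays below the next multiple of [n.+2]. *)
rewrite chain_codeS factS (@leq_trans (n.+2 * (chain_code n.+1 c).+1)) //.
  by rewrite mulnS addnC ltn_add2r cP ?leqnn.
by rewrite leq_mul2l IH.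
Qed.

(** Both halves of the theorem rest on this: codes and positions in the listing obey the same
    recursion. *)
Lemma nth_chain_code (T : Type) (x : nat -> T) (c : nat -> nat) (n : nat) :
  0 < n -> shift_bounded c n ->
  nth [::] (cyc_order x n) (chain_code n c) = shift_word x c n.
Proof.
elim: n => [|[|n] IH] // _ cP; first by rewrite /chain_code /varpi_sum big_ord0.
have cW := shift_boundedW cP.
by rewrite chain_codeS nth_cyc_order ?chain_code_lt ?cP ?leqnn //= IH ?shift_wordS.
Qed.

Lemma permword_nth_cyc_order (T : eqType) (x : nat -> T) (m k : nat) :
  0 < m -> k < m`! -> permword x m (nth [::] (cyc_order x m) k).
Proof.
elim: m k => [|[|m] IH] k // _ lt_k.
  by case: k lt_k => // _; exact: perm_refl.
have lt_q : k %/ m.+2 < m.+1`! by rewrite ltn_divLR // mulnC -factS.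
rewrite (divn_eq k m.+2) mulnC nth_cyc_order ?ltn_mod //.
by apply: permword_cshift (IH _ isT lt_q); rewrite -ltnS ltn_mod.
Qed.

(** Without repetitions [index] inverts [nth], so finding a word at its code gives its rank. From
    equal entries [cshift_inj] recovers the remainder modulo [m.+2] and the shorter word; induction
    then recovers the quotient. *)
Lemma cyc_order_uniq (T : eqType) (x : nat -> T) (m : nat) :
  distinct_symbols x -> uniq (cyc_order x m).
Proof.
move=> hx; elim: m => [|[|m] IH] //.
apply/(uniqP [::]) => k l; rewrite !inE size_cyc_order // => lt_k lt_l.
have lt_q i : i < m.+2`! -> i %/ m.+2 < m.+1`!.
  by move=> lt_i; rewrite ltn_divLR // mulnC -factS.
rewrite (divn_eq k m.+2) (divn_eq l m.+2) !(mulnC _ m.+2).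
rewrite !nth_cyc_order ?ltn_mod ?lt_q // => E.
have qP i (lt_i : i < m.+2`!) :=
  permword_nth_cyc_order x (ltn0Sn m) (lt_q i lt_i).
have le_r i : i %% m.+2 <= m.+1 by rewrite -ltnS ltn_mod.
have [Eq ->] := cshift_inj hx (qP k lt_k) (qP l lt_l) (le_r k) (le_r l) E.
congr (_ * _ + _); move: Eq.
by apply: (uniqP [::] IH); rewrite inE size_cyc_order ?lt_q.
Qed.

Theorem theorem6 (T : eqType) (x : nat -> T) (hx : distinct_symbols x)
    (n : nat) (hn : 2 <= n) :
  (forall p : seq T, permword x n p ->
     [/\ exists (P : nat -> seq T) (c : nat -> nat), shift_chain x n p P c,
         forall (P P' : nat -> seq T) (c c' : nat -> nat),
           shift_chain x n p P c -> shift_chain x n p P' c' ->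
           (forall m, 1 <= m <= n -> P m = P' m) /\
           (forall m, 2 <= m <= n -> c m = c' m) &
         forall (P : nat -> seq T) (c : nat -> nat),
           shift_chain x n p P c ->
           cyc_rank x n p < n`! /\ cyc_rank x n p = chain_code n c])
  /\
  (forall (alpha : 'I_(n`!)) (a : nat -> nat), varpi_digits n a alpha ->
     nth [::] (cyc_order x n) alpha = apply_shifts x n a).
Proof.
have n0 : 0 < n by exact: ltnW.
have endp p P c : shift_chain x n p P c -> p = shift_word x c n.
  move=> ch; have [_ PE] := shift_chainP ch.
  by case: ch => _ <- _ _; rewrite PE // n0 leqnn.
split=> [p pP|alpha a [aP ->]].
  split=> [|P P' c c' ch ch'|P c ch].
  - have [c cP ->] := shift_word_surj n0 pP.
    by exists (shift_word x c), c; exact: shift_chain_shift_word.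
  - have [cP PE] := shift_chainP ch.
    have [cP' PE'] := shift_chainP ch'.
    have Ec : forall m, 2 <= m <= n -> c m = c' m.
      by apply: shift_word_inj hx cP cP' _; rewrite -(endp _ _ _ ch) (endp _ _ _ ch').
    by split=> // m le_m; rewrite PE // PE' //; exact: eq_shift_word Ec _ le_m.
  - have [cP _] := shift_chainP ch.
    have lt_c := chain_code_lt n0 cP.
    suff E : cyc_rank x n p = chain_code n c by rewrite E.
    (* The word [p] becomes the entry at position [chain_code n c]. *)
    rewrite /cyc_rank (endp _ _ _ ch) -nth_chain_code //.
    by rewrite index_uniq ?cyc_order_uniq ?size_cyc_order.
pose c m := a (n - m).
have cP : shift_bounded c n.
  (* The digit at [n - m] is bounded by [n - (n - m) = m]. *)
  move=> m /andP[m2 le_m]; rewrite -[ltnRHS](subKn le_m) aP //.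
  by rewrite -subn1 ltn_sub2l // (leq_trans m2).
have -> : varpi_sum n a = chain_code n c.
  apply: eq_bigr => i _; rewrite /c subKn //.
  by rewrite ltnW // (leq_trans (ltn_ord i)) ?leq_pred.
(* Here [apply_shifts x n a] is [shift_word x c n] by unfolding. *)
exact: nth_chain_code.
Qed.
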